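(* Let $\beta\in\mathcal M_{\mathrm{si}}(\Omega_0)$ be ergodic (with respect to the flow $(\theta_t)_{t\in\mathbb R}$). Then either $$\lim_{\varepsilon\to0}\mathbb E^{\beta}\Big[\varepsilon\int_0^\infty e^{-\varepsilon t}\,V(\omega(t)-\omega(0))\,\mathrm dt\Big]=0$$ for all continuous $V:\mathbb R^d\to\mathbb R$ with $\lim_{|x|\to\infty}|V(x)|=0$, or there is a $\theta_t$-invariant probability measure $\mathbb Q\in\mathcal M_{\mathrm s}(\Omega_0\otimes\mathbb R^d)$ with $\mathbb Q^{(1)}=\beta$, i.e. $\beta$ is the distribution of the increments of a stationary process.
   Context: Let $d\ge1$ and let $\Omega_0$ be the space of continuous $\omega:\mathbb R\to\mathbb R^d$ with $\omega(0)=0$, with the topology of uniform convergence on bounded intervals. For $t\in\mathbb R$, $\theta_t:\Omega_0\to\Omega_0$ is $(\theta_t\omega)(s)=\omega(t+s)-\omega(t)$, and $\theta_t:\Omega_0\otimes\mathbb R^d\to\Omega_0\otimes\mathbb R^d$ is $\theta_t(\omega,x)=(\theta_t\omega,x+\omega(t))$. $\mathcal M_{\mathrm{si}}(\Omega_0)$ is the set of probability measures on $\Omega_0$ invariant under all $\theta_t$ (processes with stationary increments), and $\mathcal M_{\mathrm s}(\Omega_0\otimes\mathbb R^d)$ the set of probability measures on $\Omega_0\otimes\mathbb R^d$ invariant under all $\theta_t$ (stationary processes, identifying a continuous path $\omega:\mathbb R\to\mathbb R^d$ with $(\omega-\omega(0),\omega(0))$). For a measure $\mathbb Q$ on $\Omega_0\otimes\mathbb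 R^d$, $\mathbb Q^{(1)}$ is its marginal on $\Omega_0$. *)

(* Defs.v *)
From HB Require Import structures.
From mathcomp Require Import all_boot all_order all_algebra.
From mathcomp Require Import all_classical all_reals all_analysis.
Set Implicit Arguments. Unset Strict Implicit. Unset Printing Implicit Defensive.
Import Order.TTheory GRing.Theory Num.Theory.
Import numFieldNormedType.Exports.
Local Open Scope classical_set_scope.
Local Open Scope ring_scope.

Section Paths.
Variables (d : nat) (R : realType).

Definition Omega0 := {f : R -> 'rV[R]_d | `[< continuous f /\ f 0 = 0 >]}.

Lemma zero_path_in : `[< continuous (fun _ : R => (0 : 'rV[R]_d)) /\ (fun _ : R => (0 : 'rV[R]_d)) 0 = 0 >].
Proof. by apply/asboolP; split => // x; exact: cvg_cst. Qed.

HB.instance Definition _ := [Choice of Omega0 by <:].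
HB.instance Definition _ := isPointed.Build Omega0 (@exist (R -> 'rV[R]_d) (fun f => `[< continuous f /\ f 0 = 0 >]) (fun _ => 0) zero_path_in).

(* generators of the Borel sigma-algebra of Omega_0 (cylinder sets) *)
Definition cyl_gen : set (set Omega0) :=
  fun A => exists (t : R) (j : 'I_d) (B : set R),
    measurable B /\ A = (fun w : Omega0 => val w t ord0 j) @^-1` B.

Definition OmegaM := g_sigma_algebraType cyl_gen.

(* Borel sigma-algebra on R^d, generated by the coordinates *)
Definition rd_gen : set (set 'rV[R]_d) :=
  fun A => exists (j : 'I_d) (B : set R),
    measurable B /\ A = (fun x : 'rV[R]_d => x ord0 j) @^-1` B.

Definition RdM := g_sigma_algebraType rd_gen.

(* the shift theta_t on Omega_0 (the predicate holds, so insubd never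
   falls back on its default) *)
Definition theta (t : R) (w : OmegaM) : OmegaM :=
  insubd w (fun s => val w (t + s) - val w t).

Definition thetaX (t : R) (p : (OmegaM * RdM)%type) : (OmegaM * RdM)%type :=
  (theta t p.1, p.2 + val p.1 t).

End Paths.

Definition flow_invariant (R : realType) (disp : measure_display)
  (T : measurableType disp) (f : R -> T -> T) (P : probability T R) : Prop :=
  forall (t : R) (A : set T), measurable A -> P (f t @^-1` A) = P A.

Definition flow_ergodic (R : realType) (disp : measure_display)
  (T : measurableType disp) (f : R -> T -> T) (P : probability T R) : Prop :=
  forall A : set T, measurable A -> (forall t : R, f t @^-1` A = A) ->
    P A = 0%E \/ P A = 1%E.

Definition abel_mean (d : nat) (R : realType) (beta : probability (OmegaM d R) R)
  (V : 'rV[R]_d -> R) (eps : R) : \bar R :=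
  (\int[beta]_w (eps%:E *
     \int[lebesgue_measure]_(t in `[0%R, +oo[%classic)
        (expR (- (eps * t)) * V (val w t - val w 0))%:E))%E.

(* Main.v *)
Require Import Defs.
From HB Require Import structures.
From mathcomp Require Import all_boot all_order all_algebra.
From mathcomp Require Import all_classical all_reals all_analysis.
From mathcomp Require Import measurable_realfun ring lra.
Import Order.TTheory GRing.Theory Num.Theory.
Import numFieldNormedType.Exports.
Set Implicit Arguments. Unset Strict Implicit. Unset Printing Implicit Defensive.
Local Open Scope classical_set_scope.
Local Open Scope ring_scope.
(* A point [(w, x)] is moved by the skew product [thetaX], which preserves
   [M = beta x m] with [m] Lebesgue measure on R^d.  Start the flow from
   [beta x uniform([0,1]^d)] instead of [beta x dirac 0]: adding an independent
   uniform shift commutes with the flow, and the occupation measures with weight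
   [eps * exp (- eps * t)] are now dominated by [M].  Hence their limit along an
   ultrafilter [eps -> 0+], a priori only finitely additive, is countably
   additive on sets of finite [M]-measure; this replaces vague compactness.  Its
   countably additive part [Q] is invariant, and its first marginal is invariant
   and at most [beta], so it is a multiple of [beta] by ergodicity.  If the Abel
   means do not vanish, some tube [Omega_0 x [-r,r]^d] keeps positive mass and
   [Q] can be normalised. *)

(** * Integration *)

Section integral_domination.
Local Open Scope ereal_scope.
Context (disp : measure_display) (T : measurableType disp) (R : realType).
Variable mu : {measure set T -> \bar R}.
Import HBNNSimple.

(** The integral of a nonnegative function is a supremum over the simple functions below it, hence
    monotone for arbitrary functions. Abel means can thus be bounded without a measurability proof
    for their integrands. *)
Lemma ge0_le_integral_nonmeas (D : set T) (f g : T -> \bar R) :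
  (forall x, D x -> 0 <= f x) -> (forall x, D x -> f x <= g x) ->
  \int[mu]_(x in D) f x <= \int[mu]_(x in D) g x.
Proof.
move=> f0 fg; have g0 x : D x -> 0 <= g x.
  by move=> Dx; exact: le_trans (f0 x Dx) (fg x Dx).
rewrite (ge0_integralE mu f0) (ge0_integralE mu g0).
apply/ge_ereal_sup => _ [h /= hf <-]; apply: ereal_sup_ubound.
exists h => //= x; apply: le_trans (hf x) _.
by rewrite !patchE; case: ifPn => // /set_mem; exact: fg.
Qed.

Lemma abse_integral_le_nonmeas (D : set T) (f g : T -> \bar R) :
  (forall x, D x -> `|f x| <= g x) ->
  `|\int[mu]_(x in D) f x| <= \int[mu]_(x in D) g x.
Proof.
move=> fg.
have fp : \int[mu]_(x in D) f^\+ x <= \int[mu]_(x in D) g x.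
  apply: ge0_le_integral_nonmeas => // x Dx; apply: le_trans (fg x Dx).
  by rewrite -[`|f x|]/((abse \o f) x) fune_abse leeDl.
have fn : \int[mu]_(x in D) f^\- x <= \int[mu]_(x in D) g x.
  apply: ge0_le_integral_nonmeas => // x Dx; apply: le_trans (fg x Dx).
  by rewrite -[`|f x|]/((abse \o f) x) fune_abse leeDr.
have fp0 : 0 <= \int[mu]_(x in D) f^\+ x by exact: integral_ge0.
have fn0 : 0 <= \int[mu]_(x in D) f^\- x by exact: integral_ge0.
rewrite integralE.
move: fp fn fp0 fn0.
move: (\int[mu]_(x in D) f^\+ x) (\int[mu]_(x in D) f^\- x) (\int[mu]_(x in D) g x).
move=> [a| |] [b| |] [c| |] //=; rewrite ?leey ?lee_fin // => ac bc a0 b0.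
by rewrite ler_norml; apply/andP; split; lra.
Qed.

End integral_domination.

(** This lemma and the next four bundle a set function with a structure established in the middle of
    an argument; the equality of set functions lets facts be transported back and forth. *)
Lemma exists_sigma_finite disp (T : measurableType disp) (R : realType)
  (nu : {measure set T -> \bar R}) : sigma_finite setT nu ->
  exists nu' : {sigma_finite_measure set T -> \bar R}, nu' = nu :> (set T -> \bar R).
Proof.
move=> nuS.
pose H1 := isSFinite.Build _ _ _ (Measure.sort nu) (sfinite_measure_sigma_finite nuS).
pose H2 := isSigmaFinite.Build _ _ _ (Measure.sort nu) nuS.
pose nu' := HB.pack_for {sigma_finite_measure set T -> \bar R} (Measure.sort nu) H1 H2.
by exists nu'.
Qed.

Lemma exists_finite disp (T : measurableType disp) (R : realType)
  (nu : {measure set T -> \bar R}) : (nu setT < +oo)%E ->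
  exists nu' : {finite_measure set T -> \bar R}, nu' = nu :> (set T -> \bar R).
Proof.
move=> nuoo; have nuF : fin_num_fun nu by exact: lty_fin_num_fun.
have nuS : sigma_finite setT nu.
  by apply: fin_num_fun_sigma_finite => //; rewrite measure0.
pose H1 := isSFinite.Build _ _ _ (Measure.sort nu) (sfinite_measure_sigma_finite nuS).
pose H2 := isSigmaFinite.Build _ _ _ (Measure.sort nu) nuS.
pose H3 := isFinite.Build _ _ _ (Measure.sort nu) nuF.
pose nu' := HB.pack_for {finite_measure set T -> \bar R} (Measure.sort nu) H1 H2 H3.
by exists nu'.
Qed.

Lemma exists_probability disp (T : measurableType disp) (R : realType)
  (nu : {measure set T -> \bar R}) : (nu setT = 1)%E ->
  exists nu' : probability T R, nu' = nu :> (set T -> \bar R).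
Proof.
move=> nu1; have nuF : fin_num_fun nu by apply: lty_fin_num_fun; rewrite nu1 ltry.
have nuS : sigma_finite setT nu.
  by apply: fin_num_fun_sigma_finite => //; rewrite measure0.
have nuB : (nu setT <= 1)%E by rewrite nu1.
pose H1 := isSFinite.Build _ _ _ (Measure.sort nu) (sfinite_measure_sigma_finite nuS).
pose H2 := isSigmaFinite.Build _ _ _ (Measure.sort nu) nuS.
pose H3 := isFinite.Build _ _ _ (Measure.sort nu) nuF.
pose H4 := isSubProbability.Build _ _ _ (Measure.sort nu) nuB.
pose H5 := isProbability.Build _ _ _ (Measure.sort nu) nu1.
pose nu' := HB.pack_for (probability T R) (Measure.sort nu) H1 H2 H3 H4 H5.
by exists nu'.
Qed.

Lemma exists_measure disp (T : measurableType disp) (R : realType)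
  (f : set T -> \bar R) : f set0 = 0%E -> (forall A, (0 <= f A)%E) -> semi_sigma_additive f ->
  exists nu : {measure set T -> \bar R}, nu = f :> (set T -> \bar R).
Proof.
move=> f0 fge fs.
pose H := isMeasure.Build _ _ _ f f0 fge fs.
pose nu' := HB.pack_for {measure set T -> \bar R} f H.
by exists nu'.
Qed.

Lemma exists_pushforward (R : realType) d1 d2 (T1 : measurableType d1)
  (T2 : measurableType d2) (mu : {measure set T1 -> \bar R}) (f : T1 -> T2) :
  measurable_fun setT f ->
  exists nu : {measure set T2 -> \bar R}, nu = pushforward mu f :> (set T2 -> \bar R).
Proof.
move=> mf.
by unshelve refine (ex_intro _ (pushforward mu f : {measure set T2 -> \bar R}) _).
Qed.

Lemma ge0_integral_invariant (R : realType) disp (T : measurableType disp)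
    (mu : {measure set T -> \bar R}) (phi : T -> T) (f : T -> \bar R) :
  measurable_fun setT phi ->
  (forall A, measurable A -> mu (phi @^-1` A) = mu A) ->
  measurable_fun setT f -> (forall x, 0 <= f x)%E ->
  (\int[mu]_x f (phi x) = \int[mu]_x f x)%E.
Proof.
move=> mphi muphi mf f0; have [nu nuE] := exists_pushforward mu mphi.
transitivity (\int[nu]_x f x)%E; first by rewrite nuE ge0_integral_pushforward.
by apply: eq_measure_integral => A mA _; rewrite nuE; exact: muphi.
Qed.

(** * Translations of the line and exponential averages *)

Section translation.
Local Open Scope ereal_scope.
Context (R : realType).
Local Notation leb := (@lebesgue_measure R).

Lemma measurable_addr (s : R) :
  measurable_fun [set: measurableTypeR R]
    (fun t => (t + s)%R : measurableTypeR R).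
Proof. exact: measurable_funD. Qed.

Lemma lebesgue_measure_translate (s : R) (A : set (measurableTypeR R)) :
  measurable A -> leb ((fun t : measurableTypeR R => (t + s)%R) @^-1` A) = leb A.
Proof.
move=> mA; have [nu nuE] := exists_pushforward leb (measurable_addr s).
transitivity (nu A); first by rewrite nuE.
apply/esym/lebesgue_measure_unique => //= _ [[a b]] _ <-.
rewrite nuE /pushforward (_ : _ @^-1` _ = `](a - s)%R, (b - s)%R]%classic); last first.
  by apply/seteqP; split => x /=; rewrite !in_itv/= ltrBlDr lerBrDr.
rewrite lebesgue_measure_itv/=.
apply: etrans (esym (lebesgue_measure_itv `](a - s)%R, (b - s)%R])) => /=.
by rewrite !lte_fin ltrD2r -!EFinB opprB addrA subrK.
Qed.

Lemma ge0_integral_translate (s : R) (f : R -> \bar R) :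
  measurable_fun [set: measurableTypeR R] (f : measurableTypeR R -> \bar R) ->
  (forall t, 0 <= f t) ->
  \int[leb]_t f (t + s)%R = \int[leb]_t f t.
Proof.
move=> mf f0; apply: ge0_integral_invariant mf f0; first exact: measurable_addr.
exact: lebesgue_measure_translate.
Qed.

Lemma measurable_exp_weight (eps : R) (f : R -> \bar R) :
  (0 < eps)%R ->
  measurable_fun [set: measurableTypeR R] (f : measurableTypeR R -> \bar R) ->
  measurable_fun [set: measurableTypeR R]
    (fun t : measurableTypeR R => (exponential_pdf eps t)%:E * f t).
Proof.
move=> eps0 mf; apply: emeasurable_funM => //.
by apply/measurable_EFinP; exact: measurable_exponential_pdf.
Qed.

(* The exponential weight changes by at most a factor [expR (eps * s)] under a
   forward shift, and the half-line only loses mass. *)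
Lemma exp_average_shift (eps s : R) (f : R -> \bar R) :
  (0 < eps)%R -> (0 <= s)%R ->
  measurable_fun [set: measurableTypeR R] (f : measurableTypeR R -> \bar R) ->
  (forall t, 0 <= f t) ->
  \int[leb]_t ((exponential_pdf eps t)%:E * f (t + s)%R) <=
  (expR (eps * s))%:E * \int[leb]_t ((exponential_pdf eps t)%:E * f t).
Proof.
move=> eps0 s0 mf f0.
have p0 t : (0 <= exponential_pdf eps t)%R by apply/exponential_pdf_ge0/ltW.
have mg := measurable_exp_weight eps0 mf.
rewrite -(ge0_integral_translate s mg); last first.
  by move=> t; rewrite mule_ge0 ?lee_fin.
rewrite -ge0_integralZl//; last 2 first.
- exact: (measurableT_comp mg (measurable_addr s)).
- by move=> t _; rewrite mule_ge0 ?lee_fin.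
apply: ge0_le_integral_nonmeas => [t _|t _]; first by rewrite mule_ge0 ?lee_fin.
rewrite muleA; apply: lee_wpmul2r => //; rewrite -EFinM lee_fin.
have [t0|t0] := ltP t 0%R.
  by rewrite lt0_exponential_pdf// mulr_ge0 ?expR_ge0.
rewrite !exponential_pdfE ?addr_ge0// mulrCA -expRD.
by have -> : (eps * s + - eps * (t + s) = - eps * t)%R by ring.
Qed.

End translation.

(** * Lebesgue measure on R^d *)

Section haar.
Local Open Scope ereal_scope.
Context (R : realType).

Lemma measurable_coord d (j : 'I_d) :
  measurable_fun setT (fun x : RdM d R => (x : 'rV[R]_d) ord0 j).
Proof.
by move=> _ B mB; rewrite setTI; apply: sub_sigma_algebra; exists j, B.
Qed.

Lemma measurable_fun_RdM disp (T : measurableType disp) d (f : T -> RdM d R) :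
  (forall j : 'I_d, measurable_fun setT (fun x => (f x : 'rV[R]_d) ord0 j)) ->
  measurable_fun setT f.
Proof.
move=> mf; apply: (@measurability _ _ T (RdM d R) setT f (@rd_gen d R)) => //.
move=> _ [_ [j [B [mB ->]]] <-]; exact: (mf j).
Qed.

Definition box d (a b : R) : set (RdM d R) :=
  [set x | forall j : 'I_d, (a <= (x : 'rV[R]_d) ord0 j <= b)%R].

Lemma measurable_box d a b : measurable (@box d a b).
Proof.
rewrite (_ : box a b = \bigcap_(j in [set: 'I_d])
    (fun x : RdM d R => (x : 'rV[R]_d) ord0 j) @^-1` `[a, b]%classic); last first.
  apply/seteqP; split=> [x bx j _ /=|x bx j]; first by rewrite in_itv/= bx.
  by have := bx j I; rewrite /= in_itv.
apply: fin_bigcap_measurable => [|j _]; first exact: finite_finset.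
rewrite -[X in measurable X]setTI; apply: measurable_coord => //.
Qed.

Lemma measurable_translate d (v : 'rV[R]_d) :
  measurable_fun setT (fun x : RdM d R => (x + v)%R : RdM d R).
Proof.
apply: measurable_fun_RdM => j.
under eq_fun do rewrite mxE.
by apply: measurable_funD => //; exact: measurable_coord.
Qed.

(** The image of the product measure agrees with it on rectangles, which determine it. *)
Lemma product_measure_preserving d1 d2 (T1 : measurableType d1)
  (T2 : measurableType d2) (m1 : {sigma_finite_measure set T1 -> \bar R})
  (m2 : {sigma_finite_measure set T2 -> \bar R}) (f : T1 -> T1) (g : T2 -> T2) :
  measurable_fun setT f -> measurable_fun setT g ->
  (forall A, measurable A -> m1 (f @^-1` A) = m1 A) ->
  (forall A, measurable A -> m2 (g @^-1` A) = m2 A) ->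
  forall A, measurable A ->
    (m1 \x m2) ((fun p => (f p.1, g p.2)) @^-1` A) = (m1 \x m2) A.
Proof.
move=> mf mg f1 g2 A mA.
have mfg : measurable_fun setT (fun p : T1 * T2 => (f p.1, g p.2)).
  by apply: measurable_fun_pair => /=; apply: measurableT_comp.
have [nu nuE] := exists_pushforward (m1 \x m2)%E mfg.
transitivity (nu A); first by rewrite nuE.
apply/esym; apply: product_measure_unique => // B C mB mC.
have mfB : measurable (f @^-1` B) by rewrite -[f @^-1` B]setTI; exact: mf.
have mgC : measurable (g @^-1` C) by rewrite -[g @^-1` C]setTI; exact: mg.
rewrite nuE -[LHS]/((m1 \x m2) ((f @^-1` B) `*` (g @^-1` C))).
by rewrite product_measure1E//; congr (_ * _); [exact: f1|exact: g2].
Qed.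

(** Lebesgue measure on R^d, built by induction on [d]: a point mass for [d = 0], then the image of
    the product with Lebesgue measure on the line. Only translation invariance and the volume of
    cubes are used later. *)
Lemma exists_translation_invariant_measure d :
  exists m : {sigma_finite_measure set (RdM d R) -> \bar R},
    (forall (v : 'rV[R]_d) A, measurable A ->
      m ((fun x : RdM d R => (x + v)%R : RdM d R) @^-1` A) = m A) /\
    (forall a b, (a <= b)%R -> m (box a b) = ((b - a) ^+ d)%:E).
Proof.
elim: d => [|d [m [mT mB]]].
  exists (dirac (0%R : RdM 0 R)); split => [v A mA|a b ab].
    congr (dirac _ _); apply/seteqP; split => x /=; rewrite [(x + v)%R](_ : _ = x)//;
    by apply/rowP => -[].
  rewrite -[LHS]/(dirac (0%R : RdM 0 R) (box a b)) diracE expr0 mem_set //.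
  by case.
(* [phi] puts the scalar into coordinate 0 and the vector into the remaining ones. *)
pose phi (p : measurableTypeR R * RdM d R) : RdM d.+1 R :=
  \row_j (if unlift ord0 j is Some k then (p.2 : 'rV[R]_d) ord0 k else p.1).
have mphi : measurable_fun setT phi.
  apply: measurable_fun_RdM => j; rewrite /phi.
  under eq_fun do rewrite mxE.
  case: unliftP => [k _|_]; last exact: measurable_fst.
  by apply: (measurableT_comp (measurable_coord k)); exact: measurable_snd.
have [nu nuE] := exists_pushforward (lebesgue_measure \x m)%E mphi.
have nuB a b : (a <= b)%R -> nu (box a b) = ((b - a) ^+ d.+1)%:E.
  move=> ab; rewrite nuE /pushforward.
  rewrite (_ : _ @^-1` _ = (`[a, b]%classic : set (measurableTypeR R)) `*` box a b); last first.
    apply/seteqP; split => [[r x] /= rx|[r x] /= [rab xab] j].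
      split => [|k]; first by have := rx ord0; rewrite mxE unlift_none in_itv.
      by have := rx (lift ord0 k); rewrite mxE liftK.
    rewrite mxE; case: unliftP => [k _|_]; first exact: xab.
    by move: rab; rewrite in_itv.
  rewrite [LHS]product_measure1E//; last exact: measurable_box.
  rewrite mB// exprS EFinM; congr (_ * _).
  apply: etrans (lebesgue_measure_itv `[a, b]) _ => /=; rewrite lte_fin.
  by case: ltgtP ab => // -> _; rewrite subrr.
(* The cubes [box (- n) n] exhaust the space: [n] only has to exceed the sum of the absolute values
   of the coordinates. *)
have nuS : sigma_finite setT nu.
  exists (fun n => box (- n%:R) n%:R) => [|n].
    apply/esym/seteqP; split => // x _.
    pose r := (\sum_j `|(x : 'rV[R]_d.+1) ord0 j|)%R.
    exists (Num.truncn r).+1 => // j; rewrite -ler_norml.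
    apply: (@le_trans _ _ r); last by apply/ltW; exact: truncnS_gt.
    by rewrite /r (bigD1 j)//= lerDl sumr_ge0.
  split; first exact: measurable_box.
  by rewrite nuB ?ltry// (@le_trans _ _ 0%R)// oppr_le0.
have [nu' nu'E] := exists_sigma_finite nuS.
exists nu'; rewrite nu'E; split => // v A mA.
rewrite !nuE /pushforward.
(* [w] is [v] without coordinate 0, so [phi] carries the product of the translations by
   [v ord0 ord0] and [w] to the translation by [v]. *)
pose w : 'rV[R]_d := \row_k v ord0 (lift ord0 k).
have mphiA : measurable (phi @^-1` A) by rewrite -[phi @^-1` A]setTI; exact: mphi.
have := @product_measure_preserving _ _ _ _ lebesgue_measure m _ _
  (measurable_addr (v ord0 ord0)) (measurable_translate w)
  (@lebesgue_measure_translate _ _) (mT w) _ mphiA.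
apply: etrans; congr ((_ \x _)%E _); apply/seteqP.
suff E p : phi ((p.1 + v ord0 ord0)%R, (p.2 + w)%R) = (phi p + v)%R.
  by split=> p /=; rewrite E.
apply/rowP => j; rewrite /phi !mxE /=.
by case: unliftP => [k ->|->]; rewrite ?mxE.
Qed.

End haar.

(** * Joint measurability of the flow *)

Section paths.
Context (d : nat) (R : realType).
Local Notation Om := (OmegaM d R).

Lemma path_continuous (w : Om) : continuous (val w : R -> 'rV[R]_d).
Proof. by have /asboolP[] := valP (w : Omega0 d R). Qed.

Lemma path0 (w : Om) : val w 0 = 0 :> 'rV[R]_d.
Proof. by have /asboolP[] := valP (w : Omega0 d R). Qed.

Lemma theta_val (t : R) (w : Om) (s : R) :
  val (theta t w) s = val w (t + s) - val w t :> 'rV[R]_d.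
Proof.
rewrite /theta insubdK//; apply/asboolP; split; last by rewrite addr0 subrr.
move=> x; apply: cvgB; last exact: cvg_cst.
apply: (@cvg_comp _ _ _ (fun y => t + y) (val w) _ (nbhs (t + x))).
  by apply: cvgD; [exact: cvg_cst|exact: cvg_id].
exact: path_continuous.
Qed.

Lemma path_eq (w w' : Om) : (forall s, val w s = val w' s :> 'rV[R]_d) -> w = w'.
Proof. by move=> ww'; apply: val_inj; apply/funext. Qed.

Lemma theta_theta (s t : R) (w : Om) : theta s (theta t w) = theta (s + t) w.
Proof.
apply: path_eq => u; rewrite !theta_val addrA (addrC t s) opprB addrA.
by rewrite subrK (addrC s t).
Qed.

Lemma theta0 (w : Om) : theta 0 w = w.
Proof. by apply: path_eq => u; rewrite theta_val add0r path0 subr0. Qed.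

Lemma thetaX_thetaX (s t : R) (p : Om * RdM d R) :
  thetaX s (thetaX t p) = thetaX (s + t) p.
Proof.
rewrite /thetaX /= theta_theta theta_val; congr (_, _).
by rewrite -addrA [val p.1 t + _]addrC subrK (addrC t s).
Qed.

Lemma thetaX0 (p : Om * RdM d R) : thetaX 0 p = p.
Proof. by case: p => w x; rewrite /thetaX /= theta0 path0 addr0. Qed.

Lemma measurable_path (t : R) (j : 'I_d) :
  measurable_fun setT (fun w : Om => (val w t : 'rV[R]_d) ord0 j).
Proof.
by move=> _ B mB; rewrite setTI; apply: sub_sigma_algebra; exists t, j, B.
Qed.

Lemma measurable_fun_OmegaM disp (T : measurableType disp) (f : T -> Om) :
  (forall s (j : 'I_d), measurable_fun setT (fun x => (val (f x) s : 'rV[R]_d) ord0 j)) ->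
  measurable_fun setT f.
Proof.
move=> mf; apply: (@measurability _ _ T (OmegaM d R) setT f (@cyl_gen d R)) => //.
move=> _ [_ [s [j [B [mB ->]]]] <-]; exact: (mf s j).
Qed.

(** Time rounded down to a multiple of [1 / (n + 1)]. *)
Let grid (n : nat) (t : R) : R := (Num.floor (t * n.+1%:R))%:~R / n.+1%:R.

Let grid_le n t : `|t - grid n t| <= n.+1%:R^-1.
Proof.
have n0 : (0 : R) < n.+1%:R by rewrite ltr0n.
rewrite -(ler_pM2r n0) mulVf ?gt_eqF// -{1}(gtr0_norm n0) -normrM mulrBl.
rewrite /grid divfK ?gt_eqF// ger0_norm ?subr_ge0 ?floor_le//.
by rewrite lerBlDr -[X in X + _](mulr1z 1) -intrD addrC ltW// floorD1_gt.
Qed.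

Let grid_cvg t : grid ^~ t @ \oo --> t.
Proof.
apply/cvgrPdist_le => e e0; near=> n; apply: le_trans (grid_le n t) _.
by near: n; apply: filterS (near_infty_natSinv_lt (PosNum e0)) => n; exact: ltW.
Unshelve. all: by end_near. Qed.

(** By continuity a path is the pointwise limit of its values at the grid times, and each of these
    is constant in time on countably many cells, hence jointly measurable. *)
Lemma measurable_path2 (j : 'I_d) : measurable_fun setT
  (fun p : measurableTypeR R * Om => (val p.2 p.1 : 'rV[R]_d) ord0 j).
Proof.
apply: (@measurable_fun_cvg _ _ _ _
  (fun n (p : measurableTypeR R * Om) => (val p.2 (grid n p.1) : 'rV[R]_d) ord0 j)).
  move=> n _ B mB; rewrite setTI.
  rewrite (_ : _ @^-1` _ = \bigcup_(k in [set: int])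
     ((fun t : measurableTypeR R => (t * n.+1%:R)%R : measurableTypeR R)
          @^-1` `[k%:~R, (k + 1)%:~R[ `*`
      (fun w : Om => (val w (k%:~R / n.+1%:R) : 'rV[R]_d) ord0 j) @^-1` B)).
    apply: countable_bigcupT_measurable => // k; apply: measurableX.
      rewrite -[X in measurable X]setTI.
      have mk : measurable_fun setT (fun t : R => t * n.+1%:R) by exact: mulrr_measurable.
      exact: (mk measurableT _ (measurable_itv `[k%:~R, (k + 1)%:~R[)).
    by rewrite -[X in measurable X]setTI; exact: measurable_path.
  apply/seteqP; split=> [[t w] /= Bw|[t w] [k _ [/=]]].
    exists (Num.floor (t * n.+1%:R)) => //; split => //=.
    by rewrite in_itv/= floor_le floorD1_gt.
  by rewrite in_itv/= -floor_eq => /eqP <-.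
move=> [t w] _ /=.
apply: (@cvg_comp _ _ _ (fun n => val w (grid n t)) (fun x : 'rV[R]_d => x ord0 j) _
   (nbhs (val w t : 'rV[R]_d))).
  by apply: cvg_comp; [exact: grid_cvg|exact: path_continuous].
exact: coord_continuous.
Qed.

Lemma measurable_theta2 :
  measurable_fun setT (fun p : measurableTypeR R * Om => theta p.1 p.2).
Proof.
apply: measurable_fun_OmegaM => s j.
under eq_fun do rewrite theta_val !mxE.
apply: measurable_funB; last exact: measurable_path2.
apply: (measurableT_comp (measurable_path2 j)
  (g := fun p : measurableTypeR R * Om => ((p.1 + s)%R : measurableTypeR R, p.2))).
apply: measurable_fun_pair => //=.
by apply: (measurableT_comp (measurable_addr s)).
Qed.

Lemma measurable_thetaX2 : measurable_fun setT
  (fun p : measurableTypeR R * (Om * RdM d R) => thetaX p.1 p.2).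
Proof.
have m21 : measurable_fun setT (fun p : measurableTypeR R * (Om * RdM d R) =>
    (p.1, p.2.1)).
  by apply: measurable_fun_pair => //=; apply: measurableT_comp.
apply: measurable_fun_pair => /=.
  exact: (measurableT_comp measurable_theta2 m21).
apply: measurable_fun_RdM => j.
under eq_fun do rewrite mxE.
apply: measurable_funD; last exact: (measurableT_comp (measurable_path2 j) m21).
apply: (measurableT_comp (measurable_coord j)).
by apply: measurableT_comp.
Qed.

End paths.

(** * Finitely additive limits of occupation measures *)

Section dominated_content.
Local Open Scope ereal_scope.
Context (disp : measure_display) (T : measurableType disp) (R : realType).
Variables (M : {sigma_finite_measure set T -> \bar R}) (lam : set T -> R).
Hypothesis lam_ge0 : forall A, measurable A -> (0 <= lam A)%R.
Hypothesis lamU : forall A B, measurable A -> measurable B -> A `&` B = set0 ->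
  lam (A `|` B) = (lam A + lam B)%R.
Hypothesis lamM : forall A, measurable A -> (lam A)%:E <= M A.

Lemma content_set0 : lam set0 = 0%R.
Proof.
by apply/eqP; have /eqP := lamU measurable0 measurable0 (set0I _);
  rewrite setU0 -subr_eq subrr eq_sym.
Qed.

Lemma content_bigsetU (F : nat -> set T) (n : nat) :
  (forall i, measurable (F i)) -> trivIset setT F ->
  lam (\big[setU/set0]_(i < n) F i) = (\sum_(i < n) lam (F i))%R.
Proof.
move=> mF tF; elim: n => [|n IHn]; first by rewrite !big_ord0 content_set0.
rewrite !big_ord_recr/= lamU ?IHn//; first exact: bigsetU_measurable.
apply/seteqP; split => // x []; rewrite -bigcup_mkord => -[i /= ilt Fi] Fn.
by have /= E := tF i n I I (ex_intro _ x (conj Fi Fn)); rewrite E ltnn in ilt.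
Qed.

Lemma content_le (A B : set T) : measurable A -> measurable B -> A `<=` B ->
  (lam A <= lam B)%R.
Proof.
move=> mA mB AB; rewrite -(setDUK AB) lamU ?setDIK//; last exact: measurableD.
by rewrite lerDl lam_ge0//; exact: measurableD.
Qed.

(** Domination by [M], which is finite on [E], forces continuity at the empty set: the remainders
    [H n] of a disjoint union decrease to nothing, so [M (H n)] and with it [lam (H n)] tend to
    0. *)
Lemma content_trace_measure (E : set T) : measurable E -> M E < +oo ->
  exists nu : {measure set T -> \bar R},
    forall A, measurable A -> nu A = (lam (A `&` E))%:E.
Proof.
(* The absolute value only matters on non-measurable sets. *)
move=> mE Moo; pose f A := (`|lam (A `&` E)|%R)%:E.
have fE A : measurable A -> f A = (lam (A `&` E))%:E.
  by move=> mA; rewrite /f ger0_norm// lam_ge0//; exact: measurableI.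
have [||| nu nuE] := @exists_measure _ T R f.
- by rewrite fE// set0I content_set0.
- by move=> A; rewrite /f lee_fin.
- move=> F mF tF mUF.
  pose G n := \big[setU/set0]_(i < n) F i.
  have mG n : measurable (G n) by exact: bigsetU_measurable.
  pose H n := (\bigcup_i F i `\` G n) `&` E.
  have mH n : measurable (H n) by apply: measurableI => //; exact: measurableD.
  have MH0 : M (H n) @[n --> \oo] --> 0.
    have H0 : \bigcap_n H n = set0.
      apply/seteqP; split => // x Hx; have [[[k _ Fkx] _] _] := Hx 0%N I.
      have [[_ nG] _] := Hx k.+1 I; apply: nG; rewrite /G -bigcup_mkord.
      by exists k => /=.
    rewrite -(measure0 M) -H0; apply: nonincreasing_cvg_mu => //.
    + by apply: le_lt_trans Moo; apply: le_measure; rewrite ?inE//; exact: subIsetr.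
    + by rewrite H0.
    + move=> m n mn; apply/subsetPset => x [[Ux nG] Ex]; split => //; split => // Gx.
      by apply: nG; move: Gx; rewrite /G -!bigcup_mkord => -[i /= im Fi]; exists i => //=;
        exact: leq_trans im mn.
  have lH0 : lam (H n) @[n --> \oo] --> 0%R.
    apply: (@squeeze_cvgr _ _ _ _ (cst 0%R) (fun n => fine (M (H n)))).
    + apply: nearW => n; rewrite lam_ge0//= -lee_fin fineK ?lamM//.
      rewrite ge0_fin_numE//; apply: le_lt_trans Moo.
      by apply: le_measure; rewrite ?inE//; exact: subIsetr.
    + exact: cvg_cst.
    + exact: fine_cvg MH0.
  have SE n : \sum_(0 <= i < n) f (F i) = (lam (\bigcup_i F i `&` E) - lam (H n))%:E.
    rewrite big_mkord (eq_bigr (fun i : 'I_n => (lam (F i `&` E))%:E)); last first.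
      by move=> i _; exact: fE.
    rewrite sumEFin -(@content_bigsetU (fun i => F i `&` E))//; last 2 first.
    + by move=> i; exact: measurableI.
    + exact: trivIset_setIr.
    have -> : \big[setU/set0]_(i < n) (F i `&` E) = G n `&` E.
      by rewrite /G -bigcup_mkord -(bigcup_mkord n (fun i => F i `&` E)) setI_bigcupl.
    have GU : G n `<=` \bigcup_i F i.
      by rewrite /G -bigcup_mkord => x [i _ Fi]; exists i.
    have -> : \bigcup_i F i `&` E = G n `&` E `|` H n.
      by rewrite /H -setIUl setDUK.
    rewrite lamU ?addrK//; first exact: measurableI.
    by rewrite /H setIACA setDIK set0I.
  rewrite fE//; under eq_fun do rewrite SE.
  apply: cvg_EFin; first exact: nearW.
  rewrite -[X in _ --> X]subr0; apply: cvgB => //; exact: cvg_cst.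
by exists nu => A mA; rewrite nuE fE.
Qed.

(** [Q] sums the traces of [lam] on disjoint pieces of finite [M]-measure. Finite partial sums are
    values of [lam] on subsets, whence the inequality; [lam] may keep extra mass only on sets of
    infinite [M]-measure. *)
Lemma exists_measure_of_content : exists Q : {measure set T -> \bar R},
  (forall A, measurable A -> Q A <= (lam A)%:E) /\
  (forall A, measurable A -> M A < +oo -> Q A = (lam A)%:E).
Proof.
have [F UF mF] := sigma_finiteT M.
pose S := seqDU F.
have mS n : measurable (S n).
  by apply: measurableD; [exact: (mF n).1|
    apply: bigsetU_measurable => i _; exact: (mF i).1].
have MS n : M (S n) < +oo.
  apply: le_lt_trans (mF n).2; apply: le_measure; rewrite ?inE//; last exact: subset_seqDU.
  exact: (mF n).1.
have tS : trivIset setT S by exact: trivIset_seqDU.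
have US : \bigcup_n S n = setT by rewrite -seqDU_bigcup_eq -UF.
have /choice[nu nuE] := fun n => content_trace_measure (mS n) (MS n).
exists (mseries nu 0); split => A mA; rewrite /= /mseries.
  apply: lime_le; first by apply: is_cvg_nneseries => n _ _.
  apply: nearW => n; rewrite big_mkord (eq_bigr (fun i : 'I_n => (lam (A `&` S i))%:E)); last first.
    by move=> i _; exact: nuE.
  rewrite sumEFin lee_fin -(@content_bigsetU (fun i => A `&` S i)); last 2 first.
  - by move=> i; exact: measurableI.
  - exact: trivIset_setIl.
  apply: content_le => //; first by apply: bigsetU_measurable => i _; exact: measurableI.
  by rewrite -(bigcup_mkord n (fun i => A `&` S i)) => x [i _ []].
(* The trace of [lam] on [A] itself is countably additive, so nothing is lost when [A] is cut into
   pieces. *)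
move=> MA; have [nuA nuAE] := content_trace_measure mA MA.
rewrite -[in RHS](setTI A) -nuAE// -US measure_bigcup//.
under [RHS]eq_eseriesl do rewrite in_setT.
by apply: eq_eseriesr => n _; rewrite nuE// nuAE// setIC.
Qed.

End dominated_content.

Section ultrafilter_limit.
Context (R : realType).

(** The image of an ultrafilter is an ultrafilter, and here it contains a compact segment. *)
Lemma ultra_bounded_cvg (I : Type) (U : set_system I) (f : I -> R) (a b : R) :
  UltraFilter U -> (\forall i \near U, a <= f i <= b) -> cvg (f i @[i --> U]).
Proof.
move=> UU fab; have FU : UltraFilter (f i @[i --> U]).
  split; first exact: fmap_proper_filter.
  move=> G GF UG; apply/seteqP; split => // A GA.
  have [//|UnA] := in_ultra_setVsetC (f @^-1` A) UU.
  have /UG GnA : (f i @[i --> U]) (~` A) by [].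
  by have [x []] := filter_ex (filterI GA GnA).
have := @segment_compact R a b; rewrite compact_ultra => /(_ _ FU).
by case=> [|p [_ fp]]; [exact: fab|apply/cvg_ex; exists p].
Qed.

End ultrafilter_limit.

(** * Occupation measures of a measure-preserving flow and their invariant limit *)

Section flow.
Local Open Scope ereal_scope.
Context (disp : measure_display) (T : measurableType disp) (R : realType).
Local Notation leb := (@lebesgue_measure R).
Variables (M : {sigma_finite_measure set T -> \bar R}) (F : R -> T -> T).
Variable D : set T.
Hypothesis mF : measurable_fun setT (fun p : measurableTypeR R * T => F p.1 p.2).
Hypothesis FD : forall s t x, F s (F t x) = F (s + t)%R x.
Hypothesis F0 : forall x, F 0%R x = x.
Hypothesis MF : forall t A, measurable A -> M (F t @^-1` A) = M A.
Hypothesis mD : measurable D.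
Hypothesis MD : M D = 1.

(* As [M D = 1], this is the law, at an independent exponential time, of the flow
   started from [M] restricted to [D]. *)
Definition occupation (eps : R) (A : set T) : \bar R :=
  \int[leb]_t ((exponential_pdf eps t)%:E * M (D `&` F t @^-1` A)).

Lemma measurable_flow (t : R) (A : set T) : measurable A -> measurable (F t @^-1` A).
Proof.
move=> mA; rewrite -[X in measurable X]setTI.
have mt : measurable_fun setT (fun x : T => (t : measurableTypeR R, x)).
  by apply: measurable_fun_pair.
exact: (measurableT_comp mF mt).
Qed.

Let mvisit (t : R) A : measurable A -> measurable (D `&` F t @^-1` A).
Proof. by move=> mA; apply: measurableI => //; exact: measurable_flow. Qed.

(** The visiting probability is the [M]-measure of a section of a jointly measurable set. *)
Lemma measurable_visit (A : set T) : measurable A ->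
  measurable_fun setT (fun t : measurableTypeR R => M (D `&` F t @^-1` A)).
Proof.
move=> mA; pose S := [set p : measurableTypeR R * T | D p.2 /\ A (F p.1 p.2)].
have mS : measurable S.
  apply: measurableI; rewrite -[X in measurable X]setTI; last exact: mF.
  exact: measurable_snd.
have := measurable_fun_xsection M mS; congr (measurable_fun _ _).
apply/funext => t /=; congr (M _).
by apply/seteqP; split => x; rewrite /xsection /= inE.
Qed.

Let pdf0 (eps t : R) : (0 < eps)%R -> 0 <= (exponential_pdf eps t)%:E :> \bar R.
Proof. by move=> eps0; rewrite lee_fin; apply/exponential_pdf_ge0/ltW. Qed.

Lemma occupation_ge0 (eps : R) (A : set T) : (0 < eps)%R -> 0 <= occupation eps A.
Proof. by move=> eps0; apply: integral_ge0 => t _; rewrite mule_ge0// pdf0. Qed.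

Lemma occupation_le_cst (eps c : R) (A : set T) : (0 < eps)%R -> (0 <= c)%R ->
  (forall t, M (D `&` F t @^-1` A) <= c%:E) -> occupation eps A <= c%:E.
Proof.
move=> eps0 c0 Ac; rewrite -[leRHS]mule1 -(integral_exponential_pdf eps0).
rewrite -ge0_integralZl//; last 2 first.
- by apply/measurable_EFinP; exact: measurable_exponential_pdf.
- by move=> t _; exact: pdf0.
apply: ge0_le_integral_nonmeas => t _; first by rewrite mule_ge0// pdf0.
by rewrite muleC lee_wpmul2r// pdf0.
Qed.

Lemma occupation_le1 (eps : R) (A : set T) : (0 < eps)%R -> measurable A ->
  occupation eps A <= 1.
Proof.
move=> eps0 mA; apply: occupation_le_cst => // t.
by rewrite -MD; apply: le_measure; rewrite ?inE//; exact: mvisit.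
Qed.

(** The flow preserves [M], so at every time the visited part of [D] has measure at most [M A]. This
    uniform domination is what survives in the limit. *)
Lemma occupation_le (eps : R) (A : set T) : (0 < eps)%R -> measurable A ->
  occupation eps A <= M A.
Proof.
move=> eps0 mA; have [MA|] := ltP (M A) +oo; last by rewrite leye_eq => /eqP ->; exact: leey.
have MAfin : M A \is a fin_num by rewrite ge0_fin_numE.
rewrite -(fineK MAfin); apply: occupation_le_cst => //; first exact: fine_ge0.
move=> t; rewrite fineK// -(MF t mA).
by apply: le_measure; rewrite ?inE//; [exact: mvisit|exact: measurable_flow].
Qed.

Lemma occupationT (eps : R) : (0 < eps)%R -> occupation eps setT = 1.
Proof.
move=> eps0; rewrite -(integral_exponential_pdf eps0).
by apply: eq_integral => t _; rewrite preimage_setT setIT MD mule1.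
Qed.

Lemma occupationU (eps : R) (A B : set T) : (0 < eps)%R ->
  measurable A -> measurable B -> A `&` B = set0 ->
  occupation eps (A `|` B) = occupation eps A + occupation eps B.
Proof.
move=> eps0 mA mB AB; rewrite /occupation -ge0_integralD//; last 4 first.
- by move=> t _; rewrite mule_ge0// pdf0.
- by apply: measurable_exp_weight => //; exact: measurable_visit.
- by move=> t _; rewrite mule_ge0// pdf0.
- by apply: measurable_exp_weight => //; exact: measurable_visit.
apply: eq_integral => t _; rewrite -ge0_muleDr//; congr (_ * _).
rewrite preimage_setU setIUr measureU//; [exact: mvisit|exact: mvisit|].
apply/seteqP; split => // x [[_ Ax] [_ Bx]].
by have : (A `&` B) (F t x) by []; rewrite AB.
Qed.

Lemma occupation_flow (eps s : R) (A : set T) : (0 < eps)%R -> (0 <= s)%R ->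
  measurable A ->
  occupation eps (F s @^-1` A) <= (expR (eps * s))%:E * occupation eps A.
Proof.
move=> eps0 s0 mA.
have := exp_average_shift eps0 s0 (measurable_visit mA) (fun=> measure_ge0 _ _).
apply: le_trans; rewrite le_eqVlt; apply/orP; left; apply/eqP.
apply: eq_integral => t _; congr (_ * M (_ `&` _)).
by apply/seteqP; split=> x /=; rewrite FD addrC.
Qed.

Variable U : set_system R.
Hypothesis UU : UltraFilter U.
Hypothesis U0 : 0^'+ `<=` U.

(** On measurable sets the occupation lies in [0,1] for positive [eps], so the limit along [U]
    exists; finite additivity passes through it. *)
Let lam A : R := lim (fine (occupation eps A) @[eps --> U]).

Let Ugt0 : \forall eps \near U, (0 < eps)%R.
Proof. by apply: U0; exact: nbhs_right_gt. Qed.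

Let occ_fin eps A : (0 < eps)%R -> measurable A ->
  (fine (occupation eps A))%:E = occupation eps A.
Proof.
move=> eps0 mA; rewrite fineK// ge0_fin_numE ?occupation_ge0//.
by apply: le_lt_trans (occupation_le1 eps0 mA) _; rewrite ltry.
Qed.

Let lam_cvg A : measurable A -> fine (occupation eps A) @[eps --> U] --> lam A.
Proof.
move=> mA; apply: (@ultra_bounded_cvg _ _ _ _ 0 1) => //.
near=> eps; have eps0 : (0 < eps)%R by near: eps.
by rewrite -!lee_fin occ_fin// occupation_ge0// occupation_le1.
Unshelve. all: by end_near. Qed.

Let lam_ge0 A : measurable A -> (0 <= lam A)%R.
Proof.
move=> mA; apply: limr_ge; first by apply/cvg_ex; exists (lam A); exact: lam_cvg.
near=> eps; have eps0 : (0 < eps)%R by near: eps.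
by rewrite -lee_fin occ_fin// occupation_ge0.
Unshelve. all: by end_near. Qed.

Let lamU A B : measurable A -> measurable B -> A `&` B = set0 ->
  lam (A `|` B) = (lam A + lam B)%R.
Proof.
move=> mA mB AB; apply: cvg_lim => //.
apply: cvg_trans (cvgD (lam_cvg mA) (lam_cvg mB)).
apply: near_eq_cvg; near=> eps; have eps0 : (0 < eps)%R by near: eps.
apply: EFin_inj; rewrite EFinD !occ_fin ?occupationU//; exact: measurableU.
Unshelve. all: by end_near. Qed.

Let lamM A : measurable A -> (lam A)%:E <= M A.
Proof.
move=> mA; have [MA|] := ltP (M A) +oo; last by rewrite leye_eq => /eqP ->; exact: leey.
have MAfin : M A \is a fin_num by rewrite ge0_fin_numE.
rewrite -(fineK MAfin) lee_fin; apply: limr_le.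
  by apply/cvg_ex; exists (lam A); exact: lam_cvg.
near=> eps; have eps0 : (0 < eps)%R by near: eps.
by rewrite -lee_fin occ_fin// fineK// occupation_le.
Unshelve. all: by end_near. Qed.

Let lamT : lam setT = 1%R.
Proof.
apply: cvg_lim => //; apply: cvg_near_cst; near=> eps.
by rewrite occupationT//; near: eps.
Unshelve. all: by end_near. Qed.

(** The factor [expR (eps * s)] of [occupation_flow] tends to 1. *)
Let lam_flow_le s A : (0 <= s)%R -> measurable A -> (lam (F s @^-1` A) <= lam A)%R.
Proof.
move=> s0 mA; have mFA := measurable_flow s mA.
have e1 : (expR (eps * s) * fine (occupation eps A))%R @[eps --> U] --> (1 * lam A)%R.
  apply: cvgM; last exact: lam_cvg.
  have : expR (eps * s)%R @[eps --> 0^'+] --> (1 : R)%R.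
    have -> : (1 = expR (0 * s) :> R)%R by rewrite mul0r expR0.
    apply: cvg_at_right_filter.
    apply: (@cvg_comp _ _ _ (fun e : R => e * s)%R (@expR R) _ (nbhs (0 * s)%R));
      last exact: continuous_expR.
    exact: mulrr_continuous.
  by move=> c A' /c; exact: U0.
rewrite -[leRHS]mul1r; apply: (ler_cvg_to (lam_cvg mFA) e1).
near=> eps; have eps0 : (0 < eps)%R by near: eps.
by rewrite -lee_fin EFinM !occ_fin//; exact: occupation_flow.
Unshelve. all: by end_near. Qed.

(** The total mass is 1, so the inequality for the complement of [A] is the reverse inequality for
    [A]. *)
Let lam_flow s A : (0 <= s)%R -> measurable A -> lam (F s @^-1` A) = lam A.
Proof.
move=> s0 mA; apply/eqP; rewrite eq_le lam_flow_le//=.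
have := lam_flow_le s0 (measurableC mA).
have lamC B : measurable B -> lam (~` B) = (1 - lam B)%R.
  move=> mB; apply/eqP; rewrite eq_sym subr_eq -lamT -(setUv B) lamU//; last exact: setICr.
    by rewrite addrC.
  exact: measurableC.
rewrite preimage_setC !lamC//; last exact: measurable_flow.
by rewrite lerD2l lerN2.
Qed.

(** Upper bounds on occupations pass to [Q] on every measurable set because [Q] is at most [lam];
    lower bounds pass only where [M] is finite, since there [Q] equals [lam]. *)
Lemma exists_invariant_limit : exists Q : {measure set T -> \bar R},
  [/\ forall s A, measurable A -> Q (F s @^-1` A) = Q A,
      forall A (c : R), measurable A ->
        (forall eps, (0 < eps)%R -> occupation eps A <= c%:E) -> Q A <= c%:E &
      forall A (c : R), measurable A -> M A < +oo ->
        (\forall eps \near U, c%:E <= occupation eps A) -> c%:E <= Q A].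
Proof.
have [Q [Qle Qeq]] := exists_measure_of_content lam_ge0 lamU lamM.
have [S US mS] := sigma_finiteT M.
have Qpos s A : (0 <= s)%R -> measurable A -> Q (F s @^-1` A) = Q A.
  (* Where [M A] is infinite, [Q] may differ from [lam]. The pieces [S' n] and, by invariance of
     [M], their preimages have finite [M]-measure, so invariance of [lam] applies to each. *)
  move=> s0 mA; pose S' n := A `&` seqDU S n.
  have mS' n : measurable (S' n).
    apply: measurableI => //; apply: measurableD; first exact: (mS n).1.
    by apply: bigsetU_measurable => i _; exact: (mS i).1.
  have MS' n : M (S' n) < +oo.
    apply: le_lt_trans (mS n).2; apply: le_measure; rewrite ?inE//; first exact: (mS n).1.
    by move=> x [_ Sx]; exact: (@subset_seqDU _ S n x Sx).
  have tS' : trivIset setT S' by apply: trivIset_setIl; exact: trivIset_seqDU.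
  have AE : A = \bigcup_n S' n.
    by rewrite -setI_bigcupr -seqDU_bigcup_eq -US setIT.
  rewrite AE preimage_bigcup !measure_bigcup//; last 2 first.
  - by move=> n _; exact: measurable_flow.
  - move=> i j _ _ [x [/= Si Sj]]; apply: (tS' i j) => //; by exists (F s x).
  apply: eq_eseriesr => n _; rewrite !Qeq ?lam_flow// ?MF//; exact: measurable_flow.
exists Q; split => [s A mA|A c mA occA|A c mA MA occA].
(* For negative [s], pull the preimage back once more by the positive time [- s], which undoes
   it. *)
- have [s0|/ltW s0] := leP 0%R s; first exact: Qpos.
  rewrite -(Qpos (- s)%R (F s @^-1` A)) ?oppr_ge0//; last exact: measurable_flow.
  congr (Q _); apply/seteqP; split => x /=; by rewrite FD addrN F0.
- apply: le_trans (Qle _ mA) _; rewrite lee_fin; apply: limr_le.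
    by apply/cvg_ex; exists (lam A); exact: lam_cvg.
  near=> eps; have eps0 : (0 < eps)%R by near: eps.
  by rewrite -lee_fin occ_fin// occA.
- rewrite Qeq// lee_fin; apply: limr_ge.
    by apply/cvg_ex; exists (lam A); exact: lam_cvg.
  near=> eps; have eps0 : (0 < eps)%R by near: eps.
  by rewrite -lee_fin occ_fin//; near: eps.
Unshelve. all: by end_near. Qed.

End flow.

(** * Invariant measures dominated by an ergodic one *)

Section null_sets.
Local Open Scope ereal_scope.
Context (disp : measure_display) (T : measurableType disp) (R : realType).

Lemma positive_integral0_null (mu : {measure set T -> \bar R}) (A : set T)
    (g : T -> \bar R) : measurable A -> measurable_fun A g ->
  (forall x, A x -> 0 < g x) -> \int[mu]_(x in A) g x <= 0 -> mu A = 0.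
Proof.
move=> mA mg g0 intg.
have : \int[mu]_(x in A) `|g x| = 0.
  rewrite (eq_integral g); last by move=> x /[!inE] Ax; rewrite gee0_abs// ltW// g0.
  by apply/eqP; rewrite eq_le intg integral_ge0// => x Ax; rewrite ltW// g0.
move/(ae_eq_integral_abs mu mA mg) => -[N [mN N0 AN]].
apply/negligibleP => //; exists N; split => // x Ax; apply: AN => /= /(_ Ax) gx0.
by have := g0 x Ax; rewrite gx0 ltxx.
Qed.

(** By Tonelli, [S] is null for the product because all its horizontal sections are; hence its
    vertical sections are null off a null set, and [A] lies in that exceptional set. *)
Lemma null_xsections (mu : {sigma_finite_measure set T -> \bar R})
    d' (T' : measurableType d') (nu : {sigma_finite_measure set T' -> \bar R})
    (S : set (T * T')) (A : set T) : measurable S -> measurable A ->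
  (forall y, mu (ysection S y) = 0) ->
  (forall x, A x -> 0 < nu (xsection S x)) -> mu A = 0.
Proof.
move=> mS mA S0 AS; have mN := measurable_fun_xsection nu mS.
apply: (@positive_integral0_null _ _ (nu \o xsection S)) => //.
  exact: measurable_funTS.
apply: (@le_trans _ _ (\int[mu]_x nu (xsection S x))).
  by apply: ge0_subset_integral.
have -> : \int[mu]_x nu (xsection S x) = \int[nu]_y mu (ysection S y).
  have := @product_measure_unique _ _ _ _ _ mu nu (mu \x^ nu) _ S mS; apply.
  by move=> B C mB mC; exact: product_measure2E.
by rewrite integral0_eq.
Qed.

(** The common part has finite mass and cancels. *)
Lemma eq_measure_setD (nu : {finite_measure set T -> \bar R}) (A B : set T) :
  measurable A -> measurable B -> nu A = nu B -> nu (A `\` B) = nu (B `\` A).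
Proof.
move=> mA mB nuAB; have fin : nu (A `&` B) \is a fin_num.
  by apply: fin_num_measure; exact: measurableI.
have EA : nu A = nu (A `\` B) + nu (A `&` B) by exact: measureDI.
have EB : nu B = nu (B `\` A) + nu (A `&` B) by rewrite setIC; exact: measureDI.
by rewrite -[LHS](addeK _ fin) -[RHS](addeK _ fin) -EA -EB nuAB.
Qed.

End null_sets.

(** * Almost invariant sets and the density of an invariant measure *)

Section ergodic.
Local Open Scope ereal_scope.
Context (disp : measure_display) (T : measurableType disp) (R : realType).
Local Notation leb := (@lebesgue_measure R).
Variables (F : R -> T -> T) (P : probability T R).
Hypothesis mF : measurable_fun setT (fun p : measurableTypeR R * T => F p.1 p.2).
Hypothesis FD : forall s t x, F s (F t x) = F (s + t)%R x.
Hypothesis PF : flow_invariant F P.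
Hypothesis Perg : flow_ergodic F P.

Let mFt (t : R) (A : set T) : measurable A -> measurable (F t @^-1` A).
Proof. exact: measurable_flow. Qed.

(* The strictly invariant modification of [A] is the set of points whose orbit
   stays in [A] for almost every time. *)
Lemma ergodic_almost_invariant (A : set T) : measurable A ->
  (forall t, P (A `\` F t @^-1` A) = 0) -> P A = 0 \/ P A = 1.
Proof.
move=> mA PA.
have mswap : measurable_fun setT (fun p : T * measurableTypeR R => F p.2 p.1).
  apply: (measurableT_comp mF (g := fun p : T * measurableTypeR R => (p.2, p.1))).
  by apply: measurable_fun_pair.
pose S := [set p : T * measurableTypeR R | ~ A (F p.2 p.1)].
have mS : measurable S.
  by rewrite -[S]setTI; apply: (mswap _ (~` A)) => //; exact: measurableC.
pose A' := [set x | leb (xsection S x) = 0].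
have mA' : measurable A'.
  rewrite -[A']setTI.
  exact: (measurable_fun_xsection leb mS measurableT (emeasurable_set1 0)).
have FA' t : F t @^-1` A' = A'.
  have E x : leb (xsection S (F t x)) = leb (xsection S x).
    rewrite -[RHS](lebesgue_measure_translate t); last exact: measurable_xsection.
    congr (leb _); apply/seteqP; split => s; rewrite /xsection /= !inE /S /= FD//.
  by apply/seteqP; split => x; rewrite /A' /= E.
have PFA t : P (F t @^-1` A `\` A) = 0.
  by rewrite -[RHS](PA t); apply: eq_measure_setD (PF t mA) => //; exact: mFt.
(* A point of [A] outside [A'] has an orbit that is out of [A] for a positive amount of time, while
   for each fixed time the points of [A] that have left form a null set. *)
have N1 : P (A `\` A') = 0.
  apply: (@null_xsections _ _ _ P _ _ leb (S `&` (A `*` setT))) => [| |t|x [Ax A'x]].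
  - by apply: measurableI => //; exact: measurableX.
  - exact: measurableD.
  - rewrite -[RHS](PA t); congr (P _); apply/seteqP.
    by split => x; rewrite /ysection /= inE /S /= => -[] // ? [].
  - rewrite lt0e measure_ge0 andbT; apply/eqP => x0; apply: A'x; rewrite /A' /= -x0.
    by congr (leb _); apply/seteqP; split => t; rewrite /xsection /= !inE // => -[].
(* Symmetrically, the orbit of a point of [A'] spends almost all times in [A], and these times
   cannot form a null set since the line has positive measure. *)
have N2 : P (A' `\` A) = 0.
  apply: (@null_xsections _ _ _ P _ _ leb (~` S `&` (~` A `*` setT))) => [| |t|x [A'x Ax]].
  - by apply: measurableI; [exact: measurableC|apply: measurableX => //; exact: measurableC].
  - exact: measurableD.
  - rewrite -[RHS](PFA t); congr (P _); apply/seteqP.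
    split => x; rewrite /ysection /= inE /S /=; first by move=> [/contrapT ? []].
    by move=> [? ?]; split.
  - rewrite lt0e measure_ge0 andbT; apply/eqP => x0.
    have : leb setT = 0.
      have mSx : measurable (xsection S x) by exact: measurable_xsection.
      have : leb (~` xsection S x `|` xsection S x) =
          leb (~` xsection S x) + leb (xsection S x).
        by apply: measureU => //; [exact: measurableC|exact: setICl].
      rewrite setvU => ->.
      rewrite A'x adde0 -x0; congr (leb _); apply/seteqP.
      by split => t; rewrite /xsection /= !inE // => -[].
    apply/eqP; rewrite gt_eqF//; apply: (@lt_le_trans _ _ (leb `[0%R, 1%R])).
      by rewrite lebesgue_measure_itv/= lte_fin ltr01 oppr0 adde0 lte_fin ltr01.
    by apply: le_measure; rewrite ?inE.
have -> : P A = P A'.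
  have : P A = P (A `\` A') + P (A `&` A') by exact: measureDI.
  have : P A' = P (A' `\` A) + P (A' `&` A) by exact: measureDI.
  by rewrite N1 N2 !add0e setIC => -> ->.
by apply: Perg.
Qed.

(** Let [f] be the density of [mu] and [c] its total mass. Invariance makes the level set where [f]
    exceeds [c] almost invariant, hence trivial. It cannot have full measure, or [mu] would have
    mass above [c]; so [mu] is at most [c] times [P], and equal total masses give equality. *)
Lemma ergodic_proportional (mu : {finite_measure set T -> \bar R}) :
  (forall A, measurable A -> mu A <= P A) ->
  (forall t A, measurable A -> mu (F t @^-1` A) = mu A) ->
  forall A, measurable A -> mu A = mu setT * P A.
Proof.
move=> muP muF.
have /radon_nikodym_finite[f [f0 intf fE]] : mu `<< P.
  move=> A PA B mB BA; apply/eqP; rewrite eq_le measure_ge0 andbT.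
  by rewrite -(PA B mB BA); exact: muP.
have mf : measurable_fun setT f by exact: measurable_int intf.
have finP B : measurable B -> P B \is a fin_num by exact: fin_num_measure.
have finmu B : measurable B -> mu B \is a fin_num by exact: fin_num_measure.
have cfin := finmu _ measurableT.
pose c := fine (mu setT); have cE : mu setT = c%:E by rewrite fineK.
have c0 : 0 <= c%:E by rewrite -cE.
pose A := [set x | c%:E < f x].
have mA : measurable A.
  by rewrite -[A]setTI; exact: emeasurable_fun_o_infty.
have below B : measurable B -> B `<=` ~` A -> mu B <= c%:E * P B.
  move=> mB BA; rewrite fE// -integral_cst//; apply: ge0_le_integral_nonmeas => // x Bx.
  by rewrite leNgt; apply/negP => cf; exact: (BA x Bx).
have above B : measurable B -> B `<=` A -> mu B <= c%:E * P B -> P B = 0.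
  move=> mB BA; rewrite fE// => fB.
  have mfc : measurable_fun B (fun x => f x - c%:E).
    by apply: emeasurable_funB => //; exact: measurable_funTS.
  apply: (positive_integral0_null mB mfc) => [x Bx|].
    by rewrite sube_gt0; exact: BA.
  move: fB; rewrite -integral_cst//.
  have -> : \int[P]_(x in B) f x =
      \int[P]_(x in B) (f x - c%:E) + \int[P]_(x in B) (cst c%:E) x.
    rewrite -ge0_integralD//.
    - by apply: eq_integral => x _; rewrite subeK.
    - by move=> x Bx; rewrite sube_ge0 ?ltW//; exact: BA.
  have fc : c%:E * P B \is a fin_num by rewrite fin_numM// finP.
  by rewrite integral_cst// -leeBrDr// subee.
(* The points leaving [A] and those entering it have equal [mu]-mass and equal [P]-mass. The
   entering ones lie below the level, so the bound [below] transfers to the leaving ones, which lie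
   above it. *)
have PA t : P (A `\` F t @^-1` A) = 0.
  have mt := mFt t mA.
  have mB1 : measurable (A `\` F t @^-1` A) by exact: measurableD.
  have mB2 : measurable (F t @^-1` A `\` A) by exact: measurableD.
  apply: above => //.
  have -> : mu (A `\` F t @^-1` A) = mu (F t @^-1` A `\` A).
    by apply: eq_measure_setD => //; rewrite muF.
  have -> : P (A `\` F t @^-1` A) = P (F t @^-1` A `\` A).
    by apply: eq_measure_setD => //; exact: esym (PF t mA).
  by apply: below => // x [].
have [PA0|PA1] := ergodic_almost_invariant mA PA; last first.
  have : P A = 0.
    apply: above => //; rewrite PA1 mule1 -cE; apply: le_measure; rewrite ?inE//.
  by rewrite PA1 => /eqP; rewrite onee_eq0.
have le_c B : measurable B -> mu B <= c%:E * P B.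
  move=> mB; have mBA := measurableD mB mA; have mBIA := measurableI _ _ mB mA.
  have -> : mu B = mu (B `\` A) + mu (B `&` A) by exact: measureDI.
  have -> : mu (B `&` A) = 0.
    apply/eqP; rewrite eq_le measure_ge0 andbT; apply: le_trans (muP _ mBIA) _.
    by rewrite -PA0; apply: le_measure; rewrite ?inE//; exact: subIsetr.
  rewrite adde0; apply: le_trans (below _ mBA _) _; first by move=> x [].
  by rewrite lee_wpmul2l//; apply: le_measure; rewrite ?inE//; exact: subDsetl.
(* The reverse inequality is [le_c] for the complement of [B]. *)
move=> B mB; rewrite cE; apply/eqP; rewrite eq_le le_c//=.
have mBC := measurableC mB.
have : mu setT = mu B + mu (~` B).
  by rewrite -measureU ?setUv//; exact: setICr.
have := le_c _ mBC; rewrite probability_setC// cE.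
rewrite -(fineK (finP _ mB)) -(fineK (finmu _ mB)) -(fineK (finmu _ mBC)).
by rewrite -EFinB -!EFinM -EFinD !lee_fin => h [e]; lra.
Qed.

End ergodic.

(** * The dichotomy *)

Section rd_bounds.
Context (d : nat) (R : realType).

Lemma coord_le_norm (x : 'rV[R]_d) (j : 'I_d) : `|x ord0 j| <= `|x|.
Proof.
rewrite [leRHS]mx_normrE.
exact: (@le_bigmax _ _ _ _ (fun ij : 'I_1 * 'I_d => `|x ij.1 ij.2|) (ord0, j)).
Qed.

(** [V] is below [delta] outside a large cube and bounded on the cube by compactness. This reduces
    all test functions [V] to indicators of cubes. *)
Lemma vanishing_bound (V : 'rV[R]_d -> R) (delta : R) : continuous V ->
  (forall e : R, 0 < e -> exists M : R, forall x, M < `|x| -> `|V x| < e) ->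
  0 < delta -> exists r C : R, [/\ 0 <= r, 0 <= C &
    forall x : RdM d R, `|V x| <= delta + C * \1_(box (- r) r) x].
Proof.
move=> Vc V0 delta0; have [M VM] := V0 _ delta0.
pose r := Num.max M 0.
have cB : compact [set x : 'rV[R]_d | forall j, `[- r, r]%classic (x ord0 j)].
  exact: (@rV_compact _ d (fun=> `[- r, r]%classic) (fun=> segment_compact (a:=-r) (b:=r))).
have cV : compact (V @` [set x : 'rV[R]_d | forall j, `[- r, r]%classic (x ord0 j)]).
  by apply: continuous_compact => //; exact: continuous_subspaceT.
have [C0 [_ VC]] := compact_bounded cV.
(* Boundedness holds for every constant strictly above [C0], hence the [+ 1]; the maxima with 0 in
   [r] and [C] secure their signs. *)
pose C := Num.max (C0 + 1) 0; exists r, C; split; rewrite ?le_max ?lexx ?orbT//.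
move=> x; rewrite indicE; case: (boolP (x \in _)) => [/set_mem xb|/negP xb].
  rewrite mulr1; apply: (@le_trans _ _ C); last by rewrite lerDr ltW.
  have /VC : C0 < C by rewrite lt_max ltrDl ltr01.
  by move=> VxC; apply: (VxC (V x)); exists x.
rewrite mulr0 addr0 ltW// VM// ltNge; apply/negP => xM; apply: xb.
apply/mem_set => j; rewrite -ler_norml; apply: le_trans (coord_le_norm _ _) _.
by apply: le_trans xM _; rewrite le_max lexx.
Qed.

End rd_bounds.

(** * The skew product over the path space and its link to Abel means *)

Section skew_product.
Local Open Scope ereal_scope.
Context (d : nat) (R : realType).
Local Notation Om := (OmegaM d R).
Local Notation Rd := (RdM d R).
Variables (beta : probability Om R) (m : {sigma_finite_measure set Rd -> \bar R}).
Hypothesis mT : forall (v : 'rV[R]_d) A, measurable A ->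
  m ((fun x : Rd => (x + v)%R : Rd) @^-1` A) = m A.
Hypothesis mB : forall a b, (a <= b)%R -> m (box a b) = ((b - a) ^+ d)%:E.

Lemma sigma_finite_product : sigma_finite setT (beta \x m).
Proof.
have [G GT mG] := sigma_finiteT m; exists (fun n => setT `*` G n) => [|n].
  by rewrite -setX_bigcupr -GT setXTT.
have [mGn Gn] := mG n; split; first exact: measurableX.
by rewrite product_measure1E// [X in X * _]probability_setT mul1e.
Qed.

(** Over a fixed path [w] the fibre map is the translation by [val w t], which [m] absorbs; what
    remains is the action of [theta t] on the base, which preserves [beta]. *)
Lemma skew_product_invariant (t : R) (A : set (Om * Rd)) :
  flow_invariant (@theta d R) beta -> measurable A ->
  (beta \x m) (@thetaX d R t @^-1` A) = (beta \x m) A.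
Proof.
move=> hsi mA.
have mt : measurable_fun setT (@theta d R t).
  have mt : measurable_fun setT (fun w : Om => (t : measurableTypeR R, w)).
    by apply: measurable_fun_pair.
  exact: (measurableT_comp (@measurable_theta2 d R) mt).
transitivity (\int[beta]_w (m (xsection A (theta t w)))).
  apply: eq_integral => w _ /=.
  rewrite -[RHS](mT (val w t)); last exact: measurable_xsection.
  by congr (m _); apply/seteqP; split => x; rewrite /xsection /= !inE.
rewrite (ge0_integral_invariant (f := fun w => m (xsection A w)) mt (hsi t))//.
exact: measurable_fun_xsection.
Qed.

Variable M : {sigma_finite_measure set (Om * Rd)%type -> \bar R}.
Hypothesis ME : M = (beta \x m) :> (set (Om * Rd)%type -> \bar R).

Let K (r : R) : set (Om * Rd) := setT `*` box (- r) r.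

Lemma measurable_tube r : measurable (K r).
Proof. by apply: measurableX => //; exact: measurable_box. Qed.

Let D : set (Om * Rd) := setT `*` box 0%R 1%R.

Lemma measurable_path_in_box r :
  measurable [set p : measurableTypeR R * Om | box (- r) r (val p.2 p.1 : Rd)].
Proof.
have mv : measurable_fun setT (fun p : measurableTypeR R * Om => val p.2 p.1 : Rd).
  by apply: measurable_fun_RdM => j; exact: measurable_path2.
by rewrite -[X in measurable X]setTI; apply: mv => //; exact: measurable_box.
Qed.

Let onebox r (p : measurableTypeR R * Om) : R :=
  (\1_[set p : measurableTypeR R * Om | box (- r) r (val p.2 p.1 : Rd)] p)%R.

Let monebox r : measurable_fun setT (onebox r).
Proof. by apply: measurable_indic; exact: measurable_path_in_box. Qed.

(* A point of the unit box carried by a path value in [box (- r) r] lands in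
   [box (- (r + 1)) (r + 1)]. *)
Lemma expected_onebox_le (r t : R) : (0 <= r)%R ->
  \int[beta]_w (onebox r (t, w))%:E <=
  M (D `&` @thetaX d R t @^-1` K (r + 1)%R).
Proof.
move=> r0; pose S := [set w : Om | box (- r) r (val w t : Rd)].
have mS : measurable S.
  have mv : measurable_fun setT (fun w : Om => val w t : Rd).
    by apply: measurable_fun_RdM => j; exact: measurable_path.
  by rewrite -[S]setTI; apply: mv => //; exact: measurable_box.
have -> : \int[beta]_w (onebox r (t, w))%:E = beta S.
  have := integral_indic beta measurableT mS; rewrite setIT => <-.
  exact: eq_integral.
have -> : beta S = M (S `*` box 0%R 1%R).
  by rewrite ME product_measure1E ?mB ?subr0 ?expr1n ?mule1//; exact: measurable_box.
apply: le_measure; rewrite ?inE.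
- by apply: measurableX => //; exact: measurable_box.
- apply: measurableI; first by apply: measurableX => //; exact: measurable_box.
  exact: measurable_flow (@measurable_thetaX2 d R) t _ (measurable_tube _).
- move=> [w x] /= [Sw xb]; split => //; split => // j; rewrite /= mxE.
  by have := Sw j; have := xb j; lra.
Qed.

(** After the pointwise bound on [V], Tonelli moves the expectation inside the time integral, and
    [expected_onebox_le] passes from the path started at 0 to the smeared start [D], at the price of
    enlarging the cube by 1. *)
Lemma abel_mean_le (V : 'rV[R]_d -> R) (r C delta eps : R) :
  (0 <= r)%R -> (0 <= C)%R -> (0 < delta)%R -> (0 < eps)%R ->
  (forall x : Rd, `|V x| <= delta + C * \1_(box (- r) r) x)%R ->
  `|abel_mean beta V eps| <= delta%:E +
     C%:E * occupation M (@thetaX d R) D eps (K (r + 1)%R).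
Proof.
move=> r0 C0 delta0 eps0 VB.
pose h (p : measurableTypeR R * Om) : R := (delta + C * onebox r p)%R.
have h0 p : (0 <= h p)%R by rewrite addr_ge0 ?(ltW delta0)// mulr_ge0// /onebox indicE.
have mh : measurable_fun setT h.
  apply: measurable_funD => //; apply: measurable_funM => //; exact: monebox.
have p0 t : (0 <= exponential_pdf eps t)%R by apply/exponential_pdf_ge0/ltW.
have mp := @measurable_exponential_pdf R eps.
pose f (p : measurableTypeR R * Om) := (exponential_pdf eps p.1)%:E * (h p)%:E.
have f0 p : 0 <= f p by rewrite mule_ge0 ?lee_fin.
have mf : measurable_fun setT f.
  apply: emeasurable_funM; apply/measurable_EFinP => //.
  exact: (measurableT_comp mp measurable_fst).
have mhw w : measurable_fun setT (fun t : measurableTypeR R => h (t, w)).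
  by apply: (measurableT_comp mh); apply: measurable_fun_pair.
have mht t : measurable_fun setT (fun w : Om => h (t, w)).
  by apply: (measurableT_comp mh); apply: measurable_fun_pair.
have mot t : measurable_fun setT (fun w : Om => onebox r (t, w)).
  by apply: (measurableT_comp (monebox r)); apply: measurable_fun_pair.
have inner w : `|eps%:E * \int[lebesgue_measure]_(t in `[0%R, +oo[%classic)
      (expR (- (eps * t)) * V (val w t - val w 0))%:E| <=
    \int[lebesgue_measure]_t f (t, w).
  rewrite abseM gee0_abs ?lee_fin ?(ltW eps0)//.
  have -> : \int[lebesgue_measure]_t f (t, w) =
      eps%:E * \int[lebesgue_measure]_(t in `[0%R, +oo[%classic)
        (expR (- (eps * t)) * h (t, w))%:E.
    rewrite -ge0_integralZl ?lee_fin ?(ltW eps0)//; last 2 first.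
    - apply/measurable_EFinP; apply: measurable_funM; last exact: measurable_funTS.
      apply: measurable_funTS; apply: measurableT_comp => //.
      by apply: measurable_funN; exact: mulrl_measurable.
    - by move=> t _; rewrite lee_fin mulr_ge0 ?expR_ge0.
    rewrite [RHS]integral_mkcond; apply: eq_integral => t _.
    rewrite /f /exponential_pdf !patchE /=; case: ifPn => _; last by rewrite mul0e.
    by rewrite -!EFinM mulrA mulNr.
  apply: lee_wpmul2l; first by rewrite lee_fin ltW.
  apply: abse_integral_le_nonmeas => t _.
  rewrite abse_EFin lee_fin normrM ger0_norm ?expR_ge0//.
  by rewrite ler_wpM2l ?expR_ge0// path0 subr0; exact: VB.
apply: (@le_trans _ _ (\int[beta]_w \int[lebesgue_measure]_t f (t, w))).
  by apply: abse_integral_le_nonmeas => w _; exact: inner.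
rewrite -(@fubini_tonelli _ _ _ _ R lebesgue_measure beta f mf f0).
pose v t := M (D `&` @thetaX d R t @^-1` K (r + 1)%R).
have mv : measurable_fun setT (v : measurableTypeR R -> \bar R).
  apply: measurable_visit (@measurable_thetaX2 d R) _ _ (measurable_tube _).
  by apply: measurableX => //; exact: measurable_box.
have v0 t : 0 <= v t by [].
have intp : \int[lebesgue_measure]_t (exponential_pdf eps t)%:E = 1 :> \bar R.
  exact: integral_exponential_pdf.
(* As the exponential density has mass 1, the bound becomes a single time integral, which can be
   compared pointwise in [t]. *)
have -> : delta%:E + C%:E * occupation M (@thetaX d R) D eps (K (r + 1)%R) =
    \int[lebesgue_measure]_t ((exponential_pdf eps t)%:E * (delta%:E + C%:E * v t)).
  have -> : \int[lebesgue_measure]_t ((exponential_pdf eps t)%:E * (delta%:E + C%:E * v t)) =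
      \int[lebesgue_measure]_t (delta%:E * (exponential_pdf eps t)%:E +
        C%:E * ((exponential_pdf eps t)%:E * v t)).
    apply: eq_integral => t _.
    by rewrite ge0_muleDr ?mule_ge0 ?lee_fin ?(ltW delta0)// muleC muleCA.
  have me : measurable_fun setT (fun t : measurableTypeR R => (exponential_pdf eps t)%:E).
    by apply/measurable_EFinP.
  rewrite ge0_integralD//.
  - rewrite !ge0_integralZl ?lee_fin ?(ltW delta0)// ?intp ?mule1//.
    + exact: measurable_exp_weight.
    + by move=> t _; rewrite mule_ge0 ?lee_fin.
    + by move=> t _; rewrite lee_fin.
  - by move=> t _; rewrite mule_ge0 ?lee_fin ?(ltW delta0).
  - exact: measurable_funeM.
  - by move=> t _; rewrite !mule_ge0 ?lee_fin.
  - by apply: measurable_funeM; exact: measurable_exp_weight.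
apply: ge0_le_integral_nonmeas => t _; first exact: integral_ge0.
have -> : \int[beta]_w f (t, w) =
    (exponential_pdf eps t)%:E * \int[beta]_w (h (t, w))%:E.
  rewrite -ge0_integralZl ?lee_fin//; first by apply/measurable_EFinP.
  by move=> w _; rewrite lee_fin.
apply: lee_wpmul2l; first by rewrite lee_fin.
have -> : \int[beta]_w (h (t, w))%:E = delta%:E + C%:E * \int[beta]_w (onebox r (t, w))%:E.
  have moe : measurable_fun setT (fun w : Om => (onebox r (t, w))%:E) by apply/measurable_EFinP.
  rewrite (eq_integral (fun w => (cst delta%:E) w + C%:E * (onebox r (t, w))%:E))//.
  rewrite ge0_integralD//.
  - rewrite integral_cst// [X in _ * X + _]probability_setT mule1 ge0_integralZl//.
    by move=> w _; rewrite lee_fin /onebox indicE.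
  - by move=> w _; rewrite lee_fin ltW.
  - by move=> w _; rewrite mule_ge0 ?lee_fin// /onebox indicE.
  - exact: measurable_funeM.
by rewrite leeD2l// lee_wpmul2l ?lee_fin//; exact: expected_onebox_le.
Qed.

End skew_product.

Theorem theorem3p1 (d : nat) (R : realType) (hd : (0 < d)%N)
  (beta : probability (OmegaM d R) R)
  (hsi : flow_invariant (@theta d R) beta)
  (herg : flow_ergodic (@theta d R) beta) :
  (forall V : 'rV[R]_d -> R, continuous V ->
     (forall e : R, 0 < e -> exists M : R, forall x, M < `|x| -> `|V x| < e) ->
     abel_mean beta V eps @[eps --> 0^'+] --> 0%E)
  \/
  (exists Q : probability (OmegaM d R * RdM d R)%type R,
     flow_invariant (@thetaX d R) Q /\
     forall A : set (OmegaM d R), measurable A -> Q (fst @^-1` A) = beta A).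
Proof.
have [m [mT mB]] := exists_translation_invariant_measure R d.
have [M ME] := exists_sigma_finite (sigma_finite_product beta m).
pose D : set (OmegaM d R * RdM d R) := setT `*` box 0 1.
pose K (r : R) : set (OmegaM d R * RdM d R) := setT `*` box (- r) r.
have mD : measurable D by apply: measurableX => //; exact: measurable_box.
have mbetaX A a b : measurable A -> a <= b ->
    (M (A `*` box a b) = beta A * ((b - a) ^+ d)%:E)%E.
  move=> mA ab; rewrite ME -mB//; apply: product_measure1E => //.
  exact: measurable_box.
have MD : (M D = 1)%E by rewrite mbetaX ?ler01// subr0 expr1n mule1 probability_setT.
have MX t A : measurable A -> (M (@thetaX d R t @^-1` A) = M A)%E.
  by rewrite ME; exact: skew_product_invariant.
have mX := @measurable_thetaX2 d R.
(* The case split: either the occupation of every tube [K r] tends to 0, or some tube has occupation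
   above a fixed [e] for arbitrarily small [eps]. *)
have [small|] := pselect (forall r e : R, 0 <= r -> 0 < e ->
  \forall eps \near 0^'+, (occupation M (@thetaX d R) D eps (K r) <= e%:E)%E).
  left=> V Vc V0; have abel_le e : 0 < e ->
      \forall eps \near 0^'+, (`|abel_mean beta V eps| <= e%:E)%E.
    (* Half of [e] pays for the tail of [V], the other half for the tube; dividing by [C + 1] avoids
       a zero denominator. *)
    move=> e0; have e20 : 0 < e / 2 by rewrite divr_gt0.
    have [r [C [r0 C0 VB]]] := vanishing_bound Vc V0 e20.
    have C1 : 0 < C + 1 by rewrite ltr_pwDr.
    near=> eps; have eps0 : 0 < eps by near: eps; exact: nbhs_right_gt.
    apply: le_trans (abel_mean_le mB ME r0 C0 e20 eps0 VB) _.
    have occ : (occupation M (@thetaX d R) D eps (K (r + 1)%R) <= (e / 2 / (C + 1))%:E)%E.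
      by near: eps; apply: small; [rewrite addr_ge0|rewrite divr_gt0].
    apply: le_trans (leeD2l _ (lee_wpmul2l _ occ)) _; first by rewrite lee_fin.
    rewrite -EFinM -EFinD lee_fin [leRHS](splitr e) lerD2l mulrCA.
    by rewrite ler_piMr ?(ltW e20)// ler_pdivrMr// mul1r lerDl.
  apply/fine_cvgP; split.
    near=> eps; rewrite fin_num_abs; apply: (@le_lt_trans _ _ 1%E); last exact: ltry.
    by near: eps; exact: abel_le ltr01.
  apply/cvgrPdist_le => e e0; near=> eps.
  have : (`|abel_mean beta V eps| <= e%:E)%E by near: eps; exact: abel_le.
  by rewrite sub0r normrN /=; case: (abel_mean _ _ _) => [a||] //=; rewrite ?normr0 ?ltW.
move=> /existsNP[r /existsNP[e /not_implyP[r0 /not_implyP[e0 large]]]]; right.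
(* Restricting to the good [eps] leaves a proper filter, so an ultrafilter above it sees the tube
   with occupation at least [e]. *)
pose W := within [set eps | (e%:E <= occupation M (@thetaX d R) D eps (K r))%E] (0 : R)^'+.
have WF : ProperFilter W.
  apply: Build_ProperFilter => W0; apply: large.
  have {}W0 : \forall eps \near 0^'+,
    ~ (e%:E <= occupation M (@thetaX d R) D eps (K r))%E by exact: W0.
  apply: filterS W0 => eps occ.
  by rewrite leNgt; apply/negP => /ltW /occ.
have [U [UU WU]] := ultraFilterLemma WF.
have U0 : (0 : R)^'+ `<=` U.
  by move=> A A0; apply: WU; apply: filterS A0.
have mK : measurable (K r) by apply: measurableX => //; exact: measurable_box.
have [Q [Qinv Qle Qge]] := exists_invariant_limit mX (@thetaX_thetaX d R)
  (@thetaX0 d R) MX mD MD UU U0.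
have mfst (A : set (OmegaM d R)) : measurable A ->
    measurable (fst @^-1` A : set (OmegaM d R * RdM d R)).
  by move=> mA; rewrite -[X in measurable X]setTI; exact: measurable_fst.
(* The start [D] has first marginal [beta], which [theta] preserves, so every occupation measure has
   this marginal; mass can only be lost in passing to [Q]. *)
have Qbeta (A : set (OmegaM d R)) : measurable A -> (Q (fst @^-1` A) <= beta A)%E.
  move=> mA; have fA : (beta A \is a fin_num)%E by exact: fin_num_measure.
  rewrite -(fineK fA); apply: Qle => [|eps eps0]; first exact: mfst.
  apply: occupation_le_cst => // [|t]; first exact: fine_ge0.
  rewrite fineK// -(hsi t A mA).
  have mtA : measurable (@theta d R t @^-1` A).
    exact: (measurable_flow (@measurable_theta2 d R)).
  have -> : D `&` @thetaX d R t @^-1` (fst @^-1` A) = (@theta d R t @^-1` A) `*` box 0 1.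
    by apply/seteqP; split => [[w x] [[_ xD] Aw]|[w x] [Aw xD]]; split.
  by rewrite mbetaX// subr0 expr1n mule1.
have [mu muE] := exists_pushforward Q
  (measurable_fst : measurable_fun setT (fst : OmegaM d R * RdM d R -> OmegaM d R)).
have muoo : (mu setT < +oo)%E.
  rewrite muE; apply: le_lt_trans (Qbeta _ measurableT) _.
  by rewrite probability_setT ltry.
have [mu' mu'E] := exists_finite muoo.
have prop (A : set (OmegaM d R)) : measurable A -> (Q (fst @^-1` A) = Q setT * beta A)%E.
  move=> mA; have := ergodic_proportional (@measurable_theta2 d R)
    (@theta_theta d R) hsi herg (mu := mu'); rewrite mu'E muE /pushforward preimage_setT.
  apply => // [t B mB'].
  rewrite -[RHS](Qinv t); last exact: mfst.
  by [].
have QTfin : (Q setT \is a fin_num)%E.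
  by rewrite ge0_fin_numE//; move: muoo; rewrite muE.
(* The tube [K r] has finite [M]-measure, so its lower bound [e] is inherited by [Q]. *)
have QT0 : 0 < fine (Q setT).
  rewrite fine_gt0// -ge0_fin_numE// QTfin andbT.
  apply: (@lt_le_trans _ _ e%:E); first by rewrite lte_fin.
  apply: (@le_trans _ _ (Q (K r))); last by apply: le_measure; rewrite ?inE.
  apply: Qge => //; first by rewrite mbetaX// ?probability_setT ?mul1e ?ltry//; lra.
  by apply: WU; exact: withinT.
have QTV0 : 0 <= (fine (Q setT))^-1 by rewrite invr_ge0 ltW.
(* Dividing by the total mass turns the first marginal, a multiple of [beta] by [prop], into [beta]
   itself. *)
pose c : {nonneg R} := NngNum QTV0.
have [|Q' Q'E] := @exists_probability _ _ _ (mscale c Q).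
  by rewrite /= /mscale/= -[X in (_ * X)%E](fineK QTfin) -EFinM mulVf// gt_eqF.
exists Q'; split => [t A mA|A mA]; rewrite Q'E /= /mscale /=.
  by congr (_ * _)%E; exact: Qinv.
rewrite [X in (_ * X)%E](prop A mA) muleA -[X in (_ * X * _)%E](fineK QTfin).
by rewrite -EFinM mulVf ?mul1e// gt_eqF.
Unshelve. all: by end_near. Qed.
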